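(* Let $Z$ and $Y$ be Lipschitz stable sequence classes such that $Z(\mathbb{K})\subseteq Y(\mathbb{K})$ with $\|\cdot\|_{Y(\mathbb{K})}\le\|\cdot\|_{Z(\mathbb{K})}$ on $Z(\mathbb{K})$. Then $\left[\Pi_{(Z,Y)}^{\mathrm{Lip}_0},\pi_{(Z,Y)}^{\mathrm{Lip}}\right]$ is a Banach Lipschitz ideal.
   Context: $\mathbb{K}$ is the scalar field ($\mathbb{R}$ or $\mathbb{C}$). For Banach spaces $X,E$, $\mathcal{L}(X,E)$ is the space of bounded linear operators, and $\mathrm{Lip}_0(X,E)$ is the Banach space of Lipschitz maps $f:X\to E$ with $f(0)=0$, normed by $\mathrm{Lip}(f)=\sup_{x\ne y}\|f(x)-f(y)\|/\|x-y\|$; $\mathrm{Lip}_0(X)=\mathrm{Lip}_0(X,\mathbb{K})$. A sequence class $Z$ is an assignment that associates to each Banach space $E$ a vector subspace $Z(E)$ of $E^{\mathbb{N}}$ endowed with a complete norm $\|\cdot\|_{Z(E)}$ such that $c_{00}(E)\subseteq Z(E)\subseteq \ell_\infty(E)$ with $\|\cdot\|_\infty\le\|\cdot\|_{Z(E)}$ on $Z(E)$, and $\|e^{(j)}\|_{Z(\mathbb{K})}=1$ for all $j\in\mathbb{N}$. Here $c_{00}(E)$ is the set of finitely supported $E$-valued sequences and $e^{(j)}$ is the scalar sequence with $1$ in coordinate $j$ and $0$ elsewhere. For sequence classes $Z,Y$, a function $f\in\mathrm{Lip}_0(X,E)$ is $(Z,Y)$-summing if the induced operator $\hat f((x_n)_n)=(f(x_n))_n$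 is well-defined from $Z(X)$ into $Y(E)$ and belongs to $\mathrm{Lip}_0(Z(X),Y(E))$. The set of these functions is $\Pi_{(Z,Y)}^{\mathrm{Lip}_0}(X,E)$, and $\pi_{(Z,Y)}^{\mathrm{Lip}}(f):=\mathrm{Lip}(\hat f)$. A sequence class $Z$ is Lipschitz stable if for all Banach spaces $X,E$ one has $(\Pi_{(Z,Z)}^{\mathrm{Lip}_0}(X,E),\pi_{(Z,Z)}^{\mathrm{Lip}})=(\mathrm{Lip}_0(X,E),\mathrm{Lip})$, that is, for every $f\in\mathrm{Lip}_0(X,E)$ we have $\hat f\in\mathrm{Lip}_0(Z(X),Z(E))$ and $\mathrm{Lip}(\hat f)=\mathrm{Lip}(f)$. A Banach Lipschitz ideal is a subclass $\mathcal{A}$ of the class of all zero-preserving Lipschitz maps between Banach spaces, with a map $\|\cdot\|_{\mathcal{A}}:\mathcal{A}\to[0,\infty)$, such that for all Banach spaces $X,E$ the components $\mathcal{A}(X,E):=\mathrm{Lip}_0(X,E)\cap\mathcal{A}$ satisfy: (i) $(\mathcal{A}(X,E),\|\cdot\|_{\mathcal{A}})$ is a Banach space and $\mathrm{Lip}(f)\le\|f\|_{\mathcal{A}}$ for all $f\in\mathcal{A}(X,E)$; (ii) for all $h\in\mathrm{Lip}_0(X)$ and $y\in E$, the map $h\cdot y:x\mapsto h(x)y$ is in $\mathcal{A}(X,E)$ and $\|h\cdot y\|_{\mathcal{A}}=\mathrm{Lip}(h)\|y\|$; (iii) for all Banach spaces $X_0,E_0$, $T\in\mathcal{L}(E,E_0)$,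 $f\in\mathcal{A}(X,E)$, $h\in\mathrm{Lip}_0(X_0,X)$, one has $T\circ f\circ h\in\mathcal{A}(X_0,E_0)$ with $\|T\circ f\circ h\|_{\mathcal{A}}\le\|T\|\,\|f\|_{\mathcal{A}}\,\mathrm{Lip}(h)$. *)

(* Defs.v *)
From Stdlib Require Import Reals Lra FunctionalExtensionality.
From Coquelicot Require Import Coquelicot.

Set Implicit Arguments.
Unset Strict Implicit.
Unset Printing Implicit Defensive.

Open Scope R_scope.

Variant scalar_field := real_scalars | complex_scalars.

Definition scalar_ring (k : scalar_field) : AbsRing :=
  match k with
  | real_scalars => R_AbsRing
  | complex_scalars => C_AbsRing
  end.

Coercion scalar_ring : scalar_field >-> AbsRing.

(* Coquelicot proves C complete for the product uniform structure of R * R,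
   whereas AbsRing_NormedModule C_AbsRing uses the balls of the modulus. *)
Lemma C_ball_prod_abs (x y : C) (e : posreal) :
  ball (M := C_UniformSpace) x (e / 2) y ->
  ball (M := AbsRing_UniformSpace C_AbsRing) x e y.
Proof.
  intros [H1 H2].
  change (Rabs (fst y - fst x) < e / 2) in H1.
  change (Rabs (snd y - snd x) < e / 2) in H2.
  change (Cmod (y - x)%C < e).
  apply Rle_lt_trans with (1 := Cmod_2Rmax _).
  change (sqrt 2 * Rmax (Rabs (fst y - fst x)) (Rabs (snd y - snd x)) < e).
  assert (Hs : sqrt 2 < 2).
  { rewrite <- (sqrt_Rsqr 2) at 2; [| lra].
    apply sqrt_lt_1; unfold Rsqr; lra. }
  assert (Hm : Rmax (Rabs (fst y - fst x)) (Rabs (snd y - snd x)) < e / 2)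
    by (apply Rmax_lub_lt; assumption).
  assert (H0 : 0 <= Rmax (Rabs (fst y - fst x)) (Rabs (snd y - snd x)))
    by (eapply Rle_trans; [apply Rabs_pos | apply Rmax_l]).
  nra.
Qed.

Lemma C_ball_abs_prod (x y : C) (e : R) :
  ball (M := AbsRing_UniformSpace C_AbsRing) x e y ->
  ball (M := C_UniformSpace) x e y.
Proof.
  intros H. change (Cmod (y - x)%C < e) in H.
  assert (Hm := Rmax_Cmod (y - x)%C).
  change (Rmax (Rabs (fst y - fst x)) (Rabs (snd y - snd x))
          <= Cmod (y - x)%C) in Hm.
  split.
  - change (Rabs (fst y - fst x) < e).
    apply Rle_lt_trans with (2 := H), Rle_trans with (2 := Hm), Rmax_l.
  - change (Rabs (snd y - snd x) < e).
    apply Rle_lt_trans with (2 := H), Rle_trans with (2 := Hm), Rmax_r.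
Qed.

Lemma C_abs_complete_cauchy (F : (C -> Prop) -> Prop) :
  ProperFilter F -> cauchy (T := AbsRing_UniformSpace C_AbsRing) F ->
  forall e : posreal,
    F (ball (M := AbsRing_UniformSpace C_AbsRing)
         (CompleteSpace.lim _ C_CompleteSpace_mixin F) e).
Proof.
  intros HF Hc e.
  assert (Hc' : cauchy (T := C_UniformSpace) F).
  { intros d. destruct (Hc d) as [x Hx]. exists x.
    revert Hx. apply filter_imp. intros y. apply C_ball_abs_prod. }
  generalize (CompleteSpace.ax1 _ C_CompleteSpace_mixin F HF Hc' (pos_div_2 e)).
  apply filter_imp. intros y. apply C_ball_prod_abs.
Qed.

Lemma C_abs_close_lim (F1 F2 : (C -> Prop) -> Prop) :
  filter_le F1 F2 -> filter_le F2 F1 ->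
  close (M := AbsRing_UniformSpace C_AbsRing)
    (CompleteSpace.lim _ C_CompleteSpace_mixin F1)
    (CompleteSpace.lim _ C_CompleteSpace_mixin F2).
Proof.
  intros H1 H2 e. apply C_ball_prod_abs.
  exact (CompleteSpace.ax2 _ C_CompleteSpace_mixin F1 F2 H1 H2 (pos_div_2 e)).
Qed.

Definition C_abs_CompleteSpace_mixin :
  CompleteSpace.mixin_of (AbsRing_UniformSpace C_AbsRing) :=
  CompleteSpace.Mixin (AbsRing_UniformSpace C_AbsRing) _
    C_abs_complete_cauchy C_abs_close_lim.

Definition scalar_complete (k : scalar_field) :
  CompleteSpace.mixin_of (AbsRing_UniformSpace k) :=
  match k return CompleteSpace.mixin_of (AbsRing_UniformSpace k) with
  | real_scalars => R_CompleteSpace_mixin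
  | complex_scalars => C_abs_CompleteSpace_mixin
  end.

Definition scalar_space (k : scalar_field) : CompleteNormedModule k :=
  CompleteNormedModule.Pack k k
    (CompleteNormedModule.Class k k
       (NormedModule.class k (AbsRing_NormedModule k)) (scalar_complete k)) k.

Section FunctionModule.
Variables (K : Ring) (T : Type) (V : ModuleSpace K).

Definition fct_plus (f g : T -> V) : T -> V := fun t => plus (f t) (g t).
Definition fct_opp (f : T -> V) : T -> V := fun t => opp (f t).
Definition fct_zero : T -> V := fun _ => zero.
Definition fct_scal (a : K) (f : T -> V) : T -> V := fun t => scal a (f t).

Lemma fct_plus_comm f g : fct_plus f g = fct_plus g f.
Proof. apply functional_extensionality; intros t; exact (plus_comm _ _). Qed.
Lemma fct_plus_assoc f g h :
  fct_plus f (fct_plus g h) = fct_plus (fct_plus f g) h.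
Proof. apply functional_extensionality; intros t; exact (plus_assoc _ _ _). Qed.
Lemma fct_plus_zero_r f : fct_plus f fct_zero = f.
Proof. apply functional_extensionality; intros t; exact (plus_zero_r _). Qed.
Lemma fct_plus_opp_r f : fct_plus f (fct_opp f) = fct_zero.
Proof. apply functional_extensionality; intros t; exact (plus_opp_r _). Qed.

Definition fct_AbelianMonoid_mixin : AbelianMonoid.mixin_of (T -> V) :=
  AbelianMonoid.Mixin _ fct_plus fct_zero
    fct_plus_comm fct_plus_assoc fct_plus_zero_r.
Canonical fct_AbelianMonoid : AbelianMonoid :=
  AbelianMonoid.Pack _ fct_AbelianMonoid_mixin (T -> V).

Definition fct_AbelianGroup_mixin : AbelianGroup.mixin_of fct_AbelianMonoid :=
  AbelianGroup.Mixin fct_AbelianMonoid fct_opp fct_plus_opp_r.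
Canonical fct_AbelianGroup : AbelianGroup :=
  AbelianGroup.Pack _
    (AbelianGroup.Class _ fct_AbelianMonoid_mixin fct_AbelianGroup_mixin)
    (T -> V).

Lemma fct_scal_assoc a b f :
  fct_scal a (fct_scal b f) = fct_scal (mult a b) f.
Proof. apply functional_extensionality; intros t; exact (scal_assoc _ _ _). Qed.
Lemma fct_scal_one f : fct_scal one f = f.
Proof. apply functional_extensionality; intros t; exact (scal_one _). Qed.
Lemma fct_scal_distr_l a f g :
  fct_scal a (plus f g) = plus (fct_scal a f) (fct_scal a g).
Proof. apply functional_extensionality; intros t; exact (scal_distr_l _ _ _). Qed.
Lemma fct_scal_distr_r a b f :
  fct_scal (plus a b) f = plus (fct_scal a f) (fct_scal b f).
Proof. apply functional_extensionality; intros t; exact (scal_distr_r _ _ _). Qed.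

Definition fct_ModuleSpace_mixin : ModuleSpace.mixin_of K fct_AbelianGroup :=
  ModuleSpace.Mixin K fct_AbelianGroup fct_scal
    fct_scal_assoc fct_scal_one fct_scal_distr_l fct_scal_distr_r.
Canonical fct_ModuleSpace : ModuleSpace K :=
  ModuleSpace.Pack K (T -> V)
    (ModuleSpace.Class K _ (AbelianGroup.class fct_AbelianGroup)
       fct_ModuleSpace_mixin) (T -> V).

End FunctionModule.

(* Only used on bounded sets; the value is 0 on the empty set, so that the
   Lipschitz constant of a map on the zero space is 0. *)
Definition supremum (A : R -> Prop) : R := real (Lub_Rbar A).

(* [member] and [size] carry no axioms by themselves; see [banach_subspace]. *)
Record normed_subset (K : AbsRing) (V : ModuleSpace K) := NormedSubset {
  member : V -> Prop;
  size : V -> R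
}.

Record banach_subspace (K : AbsRing) (V : ModuleSpace K)
    (A : normed_subset V) : Prop := {
  member_zero : member A zero;
  member_plus : forall u v, member A u -> member A v -> member A (plus u v);
  member_scal : forall a u, member A u -> member A (scal a u);
  size_eq0 : forall u, member A u -> size A u = 0 -> u = zero;
  size_scal : forall a u, member A u -> size A (scal a u) = abs a * size A u;
  size_triangle : forall u v, member A u -> member A v ->
    size A (plus u v) <= size A u + size A v;
  size_complete : forall s : nat -> V,
    (forall n, member A (s n)) ->
    (forall eps : posreal, exists N : nat, forall m n : nat,
       (N <= m)%nat -> (N <= n)%nat -> size A (minus (s m) (s n)) < eps) ->
    exists l : V, member A l /\
      is_lim_seq (fun n => size A (minus (s n) l)) 0
}.

Definition whole (K : AbsRing) (E : CompleteNormedModule K) : normed_subset E :=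
  NormedSubset (fun _ : E => True) (fun x : E => norm x).

Section LipschitzMaps.
Variables (K : AbsRing) (V W : ModuleSpace K).

Definition lipschitz0 (A : normed_subset V) (B : normed_subset W)
    (F : V -> W) : Prop :=
  (forall x, member A x -> member B (F x)) /\
  F zero = zero /\
  exists L : R, forall x y, member A x -> member A y ->
    size B (minus (F x) (F y)) <= L * size A (minus x y).

Definition lipschitz_const (A : normed_subset V) (B : normed_subset W)
    (F : V -> W) : R :=
  supremum (fun r => exists x y, member A x /\ member A y /\ x <> y /\
    r = size B (minus (F x) (F y)) / size A (minus x y)).

End LipschitzMaps.

Definition Lip0 (K : AbsRing) (X E : CompleteNormedModule K) (f : X -> E) :=
  lipschitz0 (whole X) (whole E) f.

Definition Lip (K : AbsRing) (X E : CompleteNormedModule K) (f : X -> E) : R :=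
  lipschitz_const (whole X) (whole E) f.

Definition op_norm (K : AbsRing) (X E : CompleteNormedModule K)
    (T : X -> E) : R :=
  supremum (fun r => exists x : X, norm x <= 1 /\ r = norm (T x)).

Definition c00 (K : AbsRing) (E : CompleteNormedModule K) (x : nat -> E) :=
  exists N : nat, forall n : nat, (N <= n)%nat -> x n = zero.

Definition ell_infty (K : AbsRing) (E : CompleteNormedModule K) :
    normed_subset (fct_ModuleSpace nat E) :=
  NormedSubset (V := fct_ModuleSpace nat E)
    (fun x : nat -> E => exists M : R, forall n, norm (x n) <= M)
    (fun x : nat -> E => supremum (fun r => exists n, r = norm (x n))).

Definition unit_seq (k : scalar_field) (j : nat) : nat -> scalar_space k :=
  fun n => if Nat.eq_dec n j then @one k else zero.

Record sequence_class (k : scalar_field) := SequenceClass {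
  seqs :> forall E : CompleteNormedModule k,
    normed_subset (fct_ModuleSpace nat E);
  seqs_banach : forall E, banach_subspace (seqs E);
  seqs_c00 : forall (E : CompleteNormedModule k) (x : nat -> E),
    c00 x -> member (seqs E) x;
  seqs_ell_infty : forall (E : CompleteNormedModule k) (x : nat -> E),
    member (seqs E) x ->
    member (ell_infty E) x /\ size (ell_infty E) x <= size (seqs E) x;
  seqs_unit : forall j : nat,
    size (seqs (scalar_space k)) (unit_seq k j) = 1
}.

Definition induced (X E : Type) (f : X -> E) (x : nat -> X) : nat -> E :=
  fun n => f (x n).

Section Summing.
Variables (k : scalar_field) (Z Y : sequence_class k).

Definition summing (X E : CompleteNormedModule k) (f : X -> E) : Prop :=
  Lip0 f /\ lipschitz0 (Z X) (Y E) (induced f).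

Definition summing_norm (X E : CompleteNormedModule k) (f : X -> E) : R :=
  lipschitz_const (Z X) (Y E) (induced f).

Definition summing_maps (X E : CompleteNormedModule k) :
    normed_subset (fct_ModuleSpace X E) :=
  NormedSubset (V := fct_ModuleSpace X E)
    (@summing X E) (@summing_norm X E).

End Summing.

Definition lipschitz_stable (k : scalar_field) (Z : sequence_class k) : Prop :=
  forall (X E : CompleteNormedModule k),
    (forall f : X -> E, summing Z Z f <-> Lip0 f) /\
    (forall f : X -> E, Lip0 f -> summing_norm Z Z f = Lip f).

(* A class of maps between Banach spaces is given by its components A X E. *)
Record banach_lipschitz_ideal (k : scalar_field)
    (A : forall X E : CompleteNormedModule k,
       normed_subset (fct_ModuleSpace X E)) : Prop := {
  ideal_lipschitz : forall (X E : CompleteNormedModule k) (f : X -> E),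
    member (A X E) f -> Lip0 f;
  ideal_norm_ge0 : forall (X E : CompleteNormedModule k) (f : X -> E),
    member (A X E) f -> 0 <= size (A X E) f;
  ideal_banach : forall X E : CompleteNormedModule k, banach_subspace (A X E);
  ideal_norm_ge_Lip : forall (X E : CompleteNormedModule k) (f : X -> E),
    member (A X E) f -> Lip f <= size (A X E) f;
  ideal_rank_one : forall (X E : CompleteNormedModule k)
      (h : X -> scalar_space k) (y : E), Lip0 h ->
    let hy : X -> E := fun x => scal (h x : k) y in
    member (A X E) hy /\ size (A X E) hy = Lip h * norm y;
  ideal_comp : forall (X0 X E E0 : CompleteNormedModule k)
      (T : E -> E0) (f : X -> E) (h : X0 -> X),
    is_linear T -> member (A X E) f -> Lip0 h ->
    let g : X0 -> E0 := fun x => T (f (h x)) in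
    member (A X0 E0) g /\
    size (A X0 E0) g <= op_norm T * size (A X E) f * Lip h
}.

(* Main.v *)
(* If a sequence class [Z] is Lipschitz stable, applying it to [a |-> a x] shows
   that [(x, 0, 0, ...)] has norm [norm x] in [Z X].  Testing the induced
   operator on such sequences gives [Lip f <= pi f], and makes the pointwise
   limit of a [pi]-Cauchy sequence of maps available from the completeness of
   [Y E].  The ideal property comes from factoring the induced operator of
   [T o f o h] as [Z X0 -> Z X -> Y E -> Y E0], and that of [h . y] as
   [Z X -> Z K -> Y K -> Y E], the outer maps being controlled by stability. *)
Require Import Defs.
From Stdlib Require Import Reals Lra Lia Classical ClassicalEpsilon
  FunctionalExtensionality.
From Coquelicot Require Import Coquelicot.
Open Scope R_scope.
Set Bullet Behavior "Strict Subproofs".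

(** * Suprema, differences in abelian groups, limits of errors *)

Lemma supremum_ub (A : R -> Prop) (M r : R) :
  (forall s, A s -> s <= M) -> A r -> r <= supremum A.
Proof.
  intros HM Hr; unfold supremum.
  destruct (Lub_Rbar_correct A) as [Hub Hlub].
  assert (HM' := Hlub (Finite M) (fun s Hs => HM s Hs)).
  assert (Hr' := Hub r Hr).
  destruct (Lub_Rbar A); simpl in *; easy.
Qed.

(** The condition [0 <= M] accounts for the empty set, whose supremum is 0 by convention. *)
Lemma supremum_le (A : R -> Prop) (M : R) :
  0 <= M -> (forall s, A s -> s <= M) -> supremum A <= M.
Proof.
  intros H0 HM; unfold supremum.
  destruct (Lub_Rbar_correct A) as [_ Hlub].
  assert (HM' := Hlub (Finite M) (fun s Hs => HM s Hs)).
  destruct (Lub_Rbar A); simpl in *; easy.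
Qed.

(** No bound on [A] is required: an infinite least upper bound is also read as the real number 0. *)
Lemma supremum_ge0 (A : R -> Prop) :
  (forall s, A s -> 0 <= s) -> 0 <= supremum A.
Proof.
  intros H; unfold supremum.
  destruct (Lub_Rbar_correct A) as [Hub _].
  destruct (Lub_Rbar A) as [l | |] eqn:E; simpl; try lra.
  destruct (classic (exists s, A s)) as [[s Hs] | Hn].
  - apply Rle_trans with (1 := H s Hs), (Hub s Hs).
  - rewrite (is_lub_Rbar_unique A m_infty) in E; [easy |].
    split; [intros s Hs; elim Hn; now exists s | easy].
Qed.

Lemma minus_plus_plus {G : AbelianGroup} (a b c d : G) :
  minus (plus a b) (plus c d) = plus (minus a c) (minus b d).
Proof.
  unfold minus; rewrite opp_plus, <- !plus_assoc; f_equal.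
  rewrite !plus_assoc; f_equal; apply plus_comm.
Qed.

Lemma minus_minus {G : AbelianGroup} (a b : G) : minus a (minus a b) = b.
Proof.
  rewrite <- (opp_minus b a); unfold minus; rewrite opp_opp.
  rewrite plus_comm, <- plus_assoc, plus_opp_l; apply plus_zero_r.
Qed.

(* [minus_zero_r] for the [zero] obtained directly from [ModuleSpace]. *)
Lemma module_minus_zero {K : Ring} {V : ModuleSpace K} (u : V) :
  minus u (@zero V) = u.
Proof. exact (minus_zero_r u). Qed.

(** Serves to let [p] tend to infinity in a triangle inequality whose two error terms are distances
    to limits. *)
Lemma le_of_vanishing_error (a c : R) (u v : nat -> R) :
  is_lim_seq u 0 -> is_lim_seq v 0 ->
  (exists N, forall p, (N <= p)%nat -> a <= c + (u p + v p)) -> a <= c.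
Proof.
  intros Hu Hv H.
  refine (is_lim_seq_le_loc (fun _ => a) (fun p => c + (u p + v p)) a c H
            (is_lim_seq_const a) _).
  replace (Finite c) with (Finite (c + (0 + 0))) by (f_equal; ring).
  apply is_lim_seq_plus'; [apply is_lim_seq_const | now apply is_lim_seq_plus'].
Qed.

(** * Normed subspaces *)

(* [banach_subspace] without completeness. *)
Record normed_subspace {K : AbsRing} {V : ModuleSpace K} (A : normed_subset V) :
    Prop := {
  ns_zero : member A zero;
  ns_plus : forall u v, member A u -> member A v -> member A (plus u v);
  ns_scal : forall a u, member A u -> member A (scal a u);
  ns_eq0 : forall u, member A u -> size A u = 0 -> u = zero;
  ns_size_scal : forall a u, member A u -> size A (scal a u) = abs a * size A u;
  ns_triangle : forall u v, member A u -> member A v ->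
    size A (plus u v) <= size A u + size A v
}.

Lemma banach_normed {K : AbsRing} {V : ModuleSpace K} (A : normed_subset V) :
  banach_subspace A -> normed_subspace A.
Proof. now intros []; split. Qed.

Section NormedSubspace.
Context {K : AbsRing} {V : ModuleSpace K} {A : normed_subset V}.
Hypothesis HA : normed_subspace A.

Lemma ns_opp u : member A u -> member A (opp u).
Proof. intros Hu; rewrite <- scal_opp_one; now apply (ns_scal _ HA). Qed.

Lemma ns_minus u v : member A u -> member A v -> member A (minus u v).
Proof. intros Hu Hv; apply (ns_plus _ HA); [easy | now apply ns_opp]. Qed.

Lemma size_zero : size A zero = 0.
Proof.
  rewrite <- (scal_zero_l (K := K) zero), (ns_size_scal _ HA).
  - exact (Rmult_eq_0_compat_r _ _ abs_zero).
  - apply (ns_zero _ HA).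
Qed.

Lemma size_minus_self u : size A (minus u u) = 0.
Proof. rewrite minus_eq_zero; exact size_zero. Qed.

Lemma size_opp u : member A u -> size A (opp u) = size A u.
Proof.
  intros Hu; rewrite <- scal_opp_one, (ns_size_scal _ HA) by easy.
  rewrite abs_opp_one; ring.
Qed.

Lemma size_minus u v : member A u -> member A v ->
  size A (minus u v) <= size A u + size A v.
Proof.
  intros Hu Hv; rewrite <- (size_opp v) by easy.
  apply (ns_triangle _ HA); [easy | now apply ns_opp].
Qed.

(** Nonnegativity is not among the axioms; it follows from
    [0 = size A (minus u u) <= 2 * size A u]. *)
Lemma size_ge0 u : member A u -> 0 <= size A u.
Proof.
  intros Hu; assert (H := size_minus u u Hu Hu).
  rewrite size_minus_self in H; lra.
Qed.

Lemma size_minus_gt0 u v :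
  member A u -> member A v -> u <> v -> 0 < size A (minus u v).
Proof.
  intros Hu Hv Huv.
  destruct (size_ge0 (minus u v)) as [H | H]; [now apply ns_minus | easy |].
  elim Huv; apply (plus_reg_r (opp v)); rewrite plus_opp_r.
  apply (ns_eq0 _ HA); [now apply ns_minus | easy].
Qed.

End NormedSubspace.

(** * Lipschitz maps between normed subspaces *)

Section LipschitzConstant.
Context {K : AbsRing} {V W : ModuleSpace K}.
Context {A : normed_subset V} {B : normed_subset W}.
Hypotheses (HA : normed_subspace A) (HB : normed_subspace B).

Lemma lipschitz_const_le (F : V -> W) (L : R) : 0 <= L ->
  (forall x y, member A x -> member A y ->
     size B (minus (F x) (F y)) <= L * size A (minus x y)) ->
  lipschitz_const A B F <= L.
Proof.
  intros HL H; apply supremum_le; [easy |].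
  intros s (x & y & Hx & Hy & Hxy & ->).
  apply Rle_div_l; [now apply (size_minus_gt0 HA) | now apply H].
Qed.

Lemma lipschitz_const_ge0 (F : V -> W) :
  (forall x, member A x -> member B (F x)) -> 0 <= lipschitz_const A B F.
Proof.
  intros H; apply supremum_ge0; intros s (x & y & Hx & Hy & Hxy & ->).
  apply Rmult_le_pos.
  - now apply (size_ge0 HB), (ns_minus HB); apply H.
  - now apply Rlt_le, Rinv_0_lt_compat, (size_minus_gt0 HA).
Qed.

(** The constant provided by [lipschitz0] bounds the difference quotients, so their supremum is
    finite and is attained as a bound. The diagonal is treated apart, because the quotients range
    over distinct points only. *)
Lemma lipschitz_bound (F : V -> W) (x y : V) :
  lipschitz0 A B F -> member A x -> member A y ->
  size B (minus (F x) (F y)) <= lipschitz_const A B F * size A (minus x y).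
Proof.
  intros (HF & _ & L & HL) Hx Hy.
  destruct (classic (x = y)) as [-> | Hxy].
  { rewrite (size_minus_self HA), (size_minus_self HB); lra. }
  apply Rle_div_l; [now apply (size_minus_gt0 HA) |].
  apply supremum_ub with (M := L).
  - intros s (u & v & Hu & Hv & Huv & ->).
    apply Rle_div_l; [now apply (size_minus_gt0 HA) | now apply HL].
  - now exists x, y.
Qed.

Lemma lipschitz_bound0 (F : V -> W) (x : V) :
  lipschitz0 A B F -> member A x ->
  size B (F x) <= lipschitz_const A B F * size A x.
Proof.
  intros HF Hx.
  assert (H := lipschitz_bound F x zero HF Hx (ns_zero _ HA)).
  destruct HF as (_ & H0 & _); rewrite H0, !module_minus_zero in H; exact H.
Qed.

Lemma lipschitz0_zero : lipschitz0 A B (fun _ => zero).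
Proof.
  split; [intros; apply (ns_zero _ HB) |]; split; [easy |].
  exists 0; intros; rewrite (size_minus_self HB); lra.
Qed.

Lemma lipschitz0_plus (F G : V -> W) :
  lipschitz0 A B F -> lipschitz0 A B G ->
  lipschitz0 A B (fun x => plus (F x) (G x)) /\
  lipschitz_const A B (fun x => plus (F x) (G x)) <=
    lipschitz_const A B F + lipschitz_const A B G.
Proof.
  intros HF HG.
  assert (H : forall x y, member A x -> member A y ->
    size B (minus (plus (F x) (G x)) (plus (F y) (G y))) <=
    (lipschitz_const A B F + lipschitz_const A B G) * size A (minus x y)).
  { intros x y Hx Hy.
    apply Rle_trans with (1 := Req_le _ _ (f_equal (size B)
            (minus_plus_plus (F x) (G x) (F y) (G y)))).
    assert (H1 := lipschitz_bound F x y HF Hx Hy).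
    assert (H2 := lipschitz_bound G x y HG Hx Hy).
    destruct HF as [HF _], HG as [HG _].
    eapply Rle_trans; [apply (ns_triangle _ HB); apply (ns_minus HB); auto |].
    lra. }
  split; [split; [| split] |].
  - intros x Hx; apply (ns_plus _ HB); [now apply HF | now apply HG].
  - destruct HF as (_ & -> & _), HG as (_ & -> & _); apply plus_zero_r.
  - eexists; exact H.
  - apply lipschitz_const_le; [| exact H].
    apply Rplus_le_le_0_compat; apply lipschitz_const_ge0;
      [apply HF | apply HG].
Qed.

Lemma lipschitz0_scal (a : K) (F : V -> W) :
  lipschitz0 A B F ->
  lipschitz0 A B (fun x => scal a (F x)) /\
  lipschitz_const A B (fun x => scal a (F x)) <= abs a * lipschitz_const A B F.
Proof.
  intros HF.
  assert (H : forall x y, member A x -> member A y ->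
    size B (minus (scal a (F x)) (scal a (F y))) <=
    (abs a * lipschitz_const A B F) * size A (minus x y)).
  { intros x y Hx Hy; rewrite <- scal_minus_distr_l, (ns_size_scal _ HB), Rmult_assoc.
    - apply Rmult_le_compat_l; [apply abs_ge_0 | now apply lipschitz_bound].
    - now apply (ns_minus HB); apply HF. }
  split; [split; [| split] |].
  - intros x Hx; now apply (ns_scal _ HB), HF.
  - destruct HF as (_ & -> & _); apply scal_zero_r.
  - eexists; exact H.
  - apply lipschitz_const_le; [| exact H].
    apply Rmult_le_pos; [apply abs_ge_0 | apply lipschitz_const_ge0, HF].
Qed.

Lemma lipschitz0_minus (F G : V -> W) :
  lipschitz0 A B F -> lipschitz0 A B G ->
  lipschitz0 A B (fun x => minus (F x) (G x)).
Proof.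
  intros HF HG.
  replace (fun x => minus (F x) (G x))
    with (fun x => plus (F x) (scal (opp one) (G x))).
  - apply lipschitz0_plus; [easy | now apply lipschitz0_scal].
  - apply functional_extensionality; intros x; now rewrite scal_opp_one.
Qed.

(** Lipschitz bounds survive pointwise limits: the bound on [S m - S p] passes to [S m - F] as [p]
    tends to infinity. The candidate limit [F] is given here, so completeness of the target is not
    invoked. *)
Lemma lipschitz0_limit (S : nat -> V -> W) (F : V -> W) :
  (forall n, lipschitz0 A B (S n)) ->
  (forall eps : posreal, exists N : nat, forall m n : nat,
     (N <= m)%nat -> (N <= n)%nat ->
     lipschitz_const A B (fun x => minus (S m x) (S n x)) < eps) ->
  (forall x, member A x -> member B (F x)) ->
  F zero = zero ->
  (forall x, member A x ->
     is_lim_seq (fun n => size B (minus (S n x) (F x))) 0) ->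
  lipschitz0 A B F /\
  is_lim_seq (fun n => lipschitz_const A B (fun x => minus (S n x) (F x))) 0.
Proof.
  intros HS HC HF HF0 Hlim.
  assert (Hdiff : forall m n, lipschitz0 A B (fun x => minus (S m x) (S n x)))
    by (intros; now apply lipschitz0_minus).
  assert (Hbound : forall eps : posreal, exists N, forall m, (N <= m)%nat ->
    forall x y, member A x -> member A y ->
    size B (minus (minus (S m x) (F x)) (minus (S m y) (F y))) <=
      eps * size A (minus x y)).
  { intros eps; destruct (HC eps) as [N HN]; exists N; intros m Hm x y Hx Hy.
    apply le_of_vanishing_error with (1 := Hlim x Hx) (2 := Hlim y Hy).
    exists N; intros p Hp.
    (* Inserting [S p] splits the difference into the increment of [S m - S p], controlled by its
       Lipschitz constant, and the values of [S p - F] at [x] and [y], which vanish as [p] grows. *)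
    rewrite (minus_trans (S p x) (S m x)), (minus_trans (S p y) (S m y)).
    apply Rle_trans with (1 := Req_le _ _ (f_equal (size B)
            (minus_plus_plus (minus (S m x) (S p x)) (minus (S p x) (F x))
                             (minus (S m y) (S p y)) (minus (S p y) (F y))))).
    assert (HSm : forall q z, member A z -> member B (S q z))
      by (intros q; apply (HS q)).
    eapply Rle_trans;
      [apply (ns_triangle _ HB); repeat apply (ns_minus HB); auto |].
    apply Rplus_le_compat; [| apply (size_minus HB); apply (ns_minus HB); auto].
    eapply Rle_trans; [exact (lipschitz_bound _ x y (Hdiff m p) Hx Hy) |].
    apply Rmult_le_compat_r; [now apply (size_ge0 HA), (ns_minus HA) |].
    now apply Rlt_le, HN. }
  split.
  - destruct (Hbound (mkposreal 1 Rlt_0_1)) as [N HN].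
    (* [F] is Lipschitz as the difference of [S N] and [S N - F]; the latter has constant at most 1
       by [Hbound] with [eps = 1]. *)
    replace F with (fun x => minus (S N x) (minus (S N x) (F x))).
    + apply lipschitz0_minus; [easy |]; split; [| split].
      * intros x Hx; apply (ns_minus HB); [now apply (HS N) | auto].
      * rewrite HF0, module_minus_zero; apply (HS N).
      * exists 1; exact (HN N (le_n N)).
    + apply functional_extensionality; intros x; apply minus_minus.
  - apply is_lim_seq_spec; intros eps.
    (* Half of [eps], because the estimate of the constant is not strict while convergence asks for
       a strict one. *)
    destruct (Hbound (pos_div_2 eps)) as [N HN]; exists N; intros n Hn.
    rewrite Rminus_0_r, Rabs_pos_eq.
    + apply Rle_lt_trans with (eps / 2); [| destruct eps; simpl; lra].
      apply lipschitz_const_le; [destruct eps; simpl; lra | now apply HN].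
    + apply lipschitz_const_ge0; intros x Hx; apply (ns_minus HB); [| auto].
      now apply (HS n).
Qed.

End LipschitzConstant.

Lemma lipschitz0_comp {K : AbsRing} {U V W : ModuleSpace K}
    {A : normed_subset U} {B : normed_subset V} {C : normed_subset W}
    (HA : normed_subspace A) (HB : normed_subspace B) (HC : normed_subspace C)
    (F : U -> V) (G : V -> W) :
  lipschitz0 A B F -> lipschitz0 B C G ->
  lipschitz0 A C (fun x => G (F x)) /\
  lipschitz_const A C (fun x => G (F x)) <=
    lipschitz_const B C G * lipschitz_const A B F.
Proof.
  intros HF HG.
  assert (H : forall x y, member A x -> member A y ->
    size C (minus (G (F x)) (G (F y))) <=
    (lipschitz_const B C G * lipschitz_const A B F) * size A (minus x y)).
  { intros x y Hx Hy.
    eapply Rle_trans; [apply (lipschitz_bound HB HC); [easy | |]; now apply HF |].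
    rewrite Rmult_assoc; apply Rmult_le_compat_l.
    - apply (lipschitz_const_ge0 HB HC), HG.
    - now apply (lipschitz_bound HA HB). }
  split; [split; [| split] |].
  - intros x Hx; now apply HG, HF.
  - destruct HF as (_ & -> & _); apply HG.
  - eexists; exact H.
  - apply (lipschitz_const_le HA); [| exact H].
    apply Rmult_le_pos; [apply (lipschitz_const_ge0 HB HC), HG
                        | apply (lipschitz_const_ge0 HA HB), HF].
Qed.

(** * Scalars, norms and bounded linear maps *)

(** An [AbsRing] offers neither inverses nor a multiplicative modulus; both are recovered from the
    two concrete fields. *)
Lemma scalar_inverse (k : scalar_field) (a : k) :
  a <> zero -> exists b : k, mult b a = one /\ abs b * abs a = 1.
Proof.
  destruct k; simpl in *; intros Ha.
  - exists (/ a); split; [now apply Rinv_l |].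
    change (Rabs (/ a) * Rabs a = 1).
    rewrite <- Rabs_mult, Rinv_l by easy; apply Rabs_R1.
  - exists (/ a)%C; split; [now apply Cinv_l |].
    change (Cmod (/ a) * Cmod a = 1).
    rewrite <- Cmod_mult, Cinv_l by easy; apply Cmod_1.
Qed.

(** Provides the scalar that normalises a vector in [op_norm_bound], where norms are real but
    scalars may be complex. *)
Lemma scalar_of_modulus (k : scalar_field) (r : R) :
  0 <= r -> exists a : k, abs a = r.
Proof.
  destruct k; simpl; intros Hr.
  - exists r; now apply Rabs_pos_eq.
  - exists (RtoC r); change (Cmod (RtoC r) = r).
    rewrite Cmod_R; now apply Rabs_pos_eq.
Qed.

(** The axiom [norm_scal] gives one inequality; applying it to the inverse scalar and to [scal a x]
    gives the other. *)
Lemma norm_scal_eq (k : scalar_field) (E : NormedModule k) (a : k) (x : E) :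
  norm (scal a x) = abs a * norm x.
Proof.
  apply Rle_antisym; [exact (norm_scal a x) |].
  destruct (classic (a = zero)) as [-> | Ha].
  { rewrite (Rmult_eq_0_compat_r _ _ abs_zero); apply norm_ge_0. }
  destruct (scalar_inverse k a Ha) as (b & Hba & Hb).
  assert (H := norm_scal b (scal a x)).
  rewrite scal_assoc, Hba, scal_one in H.
  assert (H1 := Rmult_le_compat_l _ _ _ (abs_ge_0 a) H).
  rewrite <- Rmult_assoc, (Rmult_comm (abs a) (abs b)), Hb in H1.
  lra.
Qed.

Lemma whole_normed (k : scalar_field) (E : CompleteNormedModule k) :
  normed_subspace (whole E).
Proof.
  split; simpl; try easy.
  - intros u _ Hu; exact (norm_eq_zero (V := E) u Hu).
  - intros a u _; apply norm_scal_eq.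
  - intros u v _ _; exact (norm_triangle (V := E) u v).
Qed.

Lemma op_norm_bound (k : scalar_field) (X E : CompleteNormedModule k)
    (T : X -> E) (x : X) :
  is_linear T -> norm (T x) <= op_norm T * norm x.
Proof.
  intros HT.
  destruct (classic (x = zero)) as [-> | Hx].
  { assert (HX : norm (zero : X) = 0) by exact norm_zero.
    assert (HE : norm (T (zero : X)) = 0)
      by exact (eq_trans (f_equal norm (linear_zero T HT)) norm_zero).
    rewrite HX, HE; lra. }
  assert (Hn : 0 < norm x) by (apply (norm_gt_0 (V := X)); exact Hx).
  destruct (scalar_of_modulus k (/ norm x)) as [a Ha].
  { now apply Rlt_le, Rinv_0_lt_compat. }
  assert (H : norm (T (scal a x)) <= op_norm T).
  (* Boundedness of [T], which is part of [is_linear], makes the supremum defining [op_norm T]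
     finite; [scal a x] is a unit vector. *)
  { destruct (linear_norm _ HT) as (M & HM & HTM).
    apply supremum_ub with (M := M).
    - intros s (y & Hy & ->); specialize (HTM y); nra.
    - exists (scal a x); split; [| easy].
      rewrite norm_scal_eq, Ha; right; field; lra. }
  rewrite (linear_scal T HT a x : T (scal a x) = scal a (T x)) in H.
  rewrite norm_scal_eq, Ha in H.
  apply Rmult_le_reg_l with (/ norm x); [now apply Rinv_0_lt_compat |].
  replace (/ norm x * (op_norm T * norm x)) with (op_norm T) by (field; lra).
  exact H.
Qed.

Lemma linear_Lip (k : scalar_field) (X E : CompleteNormedModule k) (T : X -> E) :
  is_linear T -> Lip0 T /\ Lip T <= op_norm T.
Proof.
  intros HT.
  assert (H : forall x y : X,
            norm (minus (T x) (T y)) <= op_norm T * norm (minus x y)).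
  { intros x y.
    rewrite <- (linear_minus T x y HT : T (minus x y) = minus (T x) (T y)).
    now apply op_norm_bound. }
  split; [split; [easy | split] |].
  - exact (linear_zero T HT).
  - exists (op_norm T); intros x y _ _; apply H.
  - apply (lipschitz_const_le (B := whole E) (whole_normed k X) T);
      [| intros x y _ _; apply H].
    apply supremum_ge0; intros s (y & _ & ->); apply norm_ge_0.
Qed.

(** Used twice through stability: with [Z], to measure one-term sequences, and with [Y], as the last
    factor of [h . y]. *)
Lemma line_Lip (k : scalar_field) (E : CompleteNormedModule k) (y : E) :
  Lip0 (X := scalar_space k) (fun a : k => scal a y) /\
  Lip (X := scalar_space k) (fun a : k => scal a y) <= norm y.
Proof.
  assert (H : forall a b : k,
            norm (minus (scal a y) (scal b y)) <= norm y * abs (minus a b)).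
  { intros a b; rewrite <- scal_minus_distr_r, norm_scal_eq.
    right; apply Rmult_comm. }
  split; [split; [easy | split] |].
  - apply (scal_zero_l (K := k)).
  - exists (norm y); intros a b _ _; exact (H a b).
  - apply (lipschitz_const_le (B := whole E) (whole_normed k (scalar_space k))
             (fun a : k => scal a y));
      [apply norm_ge_0 | intros a b _ _; exact (H a b)].
Qed.

(** * Sequence classes and the effect of stability *)

Section SequenceClasses.
Context {k : scalar_field}.

Definition head_seq {X : CompleteNormedModule k} (x : X) : nat -> X :=
  fun n => match n with O => x | _ => zero end.

Lemma head_seq_member (Z : sequence_class k) (X : CompleteNormedModule k) (x : X) :
  member (Z X) (head_seq x).
Proof.
  apply seqs_c00; exists 1%nat; intros [| n] Hn; [lia | easy].
Qed.

Lemma seqs_normed (Z : sequence_class k) (X : CompleteNormedModule k) :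
  normed_subspace (Z X).
Proof. apply banach_normed, seqs_banach. Qed.

Lemma seqs_coord (Z : sequence_class k) (X : CompleteNormedModule k)
    (x : nat -> X) (n : nat) :
  member (Z X) x -> norm (x n) <= size (Z X) x.
Proof.
  intros Hx; destruct (seqs_ell_infty Hx) as [[M HM] Hle].
  apply Rle_trans with (2 := Hle); simpl.
  apply supremum_ub with (M := M); [intros s [m ->]; apply HM | now exists n].
Qed.

(** The axioms normalise unit sequences of scalars only. Stability carries this over to [X]:
    [head_seq x] is the image of [unit_seq k 0] under the operator induced by [a |-> scal a x],
    whose constant is at most [norm x]. *)
Lemma head_seq_size (Z : sequence_class k) (X : CompleteNormedModule k) (x : X) :
  lipschitz_stable Z -> size (Z X) (head_seq x) <= norm x.
Proof.
  intros HZ.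
  destruct (line_Lip k X x) as [HL Hc].
  destruct (HZ (scalar_space k) X) as [H1 H2].
  rewrite <- (H2 _ HL) in Hc; apply H1 in HL; destruct HL as [_ HL].
  assert (Hu : member (Z (scalar_space k)) (unit_seq k 0)).
  { apply seqs_c00; exists 1%nat; intros n Hn; unfold unit_seq.
    destruct (Nat.eq_dec n 0); [lia | easy]. }
  assert (H := lipschitz_bound0 (seqs_normed Z _) (seqs_normed Z _) _ _ HL Hu).
  rewrite (seqs_unit Z 0), Rmult_1_r in H.
  replace (head_seq x)
    with (induced (E := X) (fun a : k => scal a x) (unit_seq k 0));
    [now apply Rle_trans with (1 := H) |].
  apply functional_extensionality; intros [| n].
  - exact (scal_one (K := k) x).
  - exact (scal_zero_l (K := k) x).
Qed.

(** [f x - f y] is coordinate 0 of the difference of the images of [head_seq x] and [head_seq y].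
    Coordinates are dominated by the norm of [Y E], and [head_seq_size] bounds the distance of the
    two arguments. *)
Lemma induced_Lip (Z Y : sequence_class k) (X E : CompleteNormedModule k)
    (f : X -> E) :
  lipschitz_stable Z -> lipschitz0 (Z X) (Y E) (induced f) ->
  Lip0 f /\ Lip f <= summing_norm Z Y f.
Proof.
  intros HZ Hf.
  assert (HNZ := seqs_normed Z X); assert (HNY := seqs_normed Y E).
  assert (H : forall x y : X,
            norm (minus (f x) (f y)) <= summing_norm Z Y f * norm (minus x y)).
  { intros x y.
    assert (H := lipschitz_bound HNZ HNY _ (head_seq x) (head_seq y) Hf
                   (head_seq_member Z X x) (head_seq_member Z X y)).
    assert (Hd : minus (head_seq x) (head_seq y) = head_seq (minus x y)).
    { apply functional_extensionality; intros [| n]; [easy |].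
      exact (minus_eq_zero _). }
    eapply Rle_trans; [| eapply Rle_trans; [exact H |]].
    - refine (seqs_coord Y E _ 0 _).
      apply (ns_minus HNY); apply Hf, head_seq_member.
    - apply Rmult_le_compat_l; [apply (lipschitz_const_ge0 HNZ HNY), Hf |].
      apply Rle_trans with (1 := Req_le _ _ (f_equal (size (Z X)) Hd)).
      now apply head_seq_size. }
  split; [split; [easy | split] |].
  - destruct Hf as (_ & H0 & _); exact (f_equal (fun u => u 0%nat) H0).
  - exists (summing_norm Z Y f); intros x y _ _; apply H.
  - apply (lipschitz_const_le (B := whole E) (whole_normed k X) f);
      [| intros x y _ _; apply H].
    apply (lipschitz_const_ge0 HNZ HNY), Hf.
Qed.

Lemma summing_of_induced (Z Y : sequence_class k) (X E : CompleteNormedModule k)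
    (f : X -> E) :
  lipschitz_stable Z -> lipschitz0 (Z X) (Y E) (induced f) -> summing Z Y f.
Proof. intros HZ Hf; split; [now apply (induced_Lip Z Y) | exact Hf]. Qed.

Lemma stable_induced (Z : sequence_class k) (X E : CompleteNormedModule k)
    (f : X -> E) :
  lipschitz_stable Z -> Lip0 f ->
  lipschitz0 (Z X) (Z E) (induced f) /\
  lipschitz_const (Z X) (Z E) (induced f) = Lip f.
Proof.
  intros HZ Hf; destruct (HZ X E) as [H1 H2].
  split; [now apply H1 | now apply H2].
Qed.

(** * Completeness of the space of summing maps *)

Lemma norm_limit_unique {E : NormedModule k} (u : nat -> E) (a b : E) :
  is_lim_seq (fun n => norm (minus (u n) a)) 0 ->
  is_lim_seq (fun n => norm (minus (u n) b)) 0 -> a = b.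
Proof.
  intros Ha Hb.
  assert (H : norm (minus a b) <= 0).
  { apply le_of_vanishing_error with (1 := Ha) (2 := Hb).
    exists 0%nat; intros p _.
    rewrite (minus_trans (u p) a b), <- (opp_minus (u p) a), Rplus_0_l.
    eapply Rle_trans; [exact (norm_triangle _ _) |].
    rewrite norm_opp; lra. }
  apply (plus_reg_r (opp b)); rewrite plus_opp_r.
  apply (norm_eq_zero (minus a b)), Rle_antisym; [easy | apply norm_ge_0].
Qed.

(** The images of each sequence in [Z X] converge in [Y E]. Their limits are identified
    coordinatewise with the images under one map [f], and [lipschitz0_limit] then upgrades this to
    convergence of the Lipschitz constants. *)
Lemma summing_complete (Z Y : sequence_class k) (X E : CompleteNormedModule k)
    (s : nat -> X -> E) :
  lipschitz_stable Z -> (forall n, summing Z Y (s n)) ->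
  (forall eps : posreal, exists N : nat, forall m n : nat,
     (N <= m)%nat -> (N <= n)%nat ->
     summing_norm Z Y (fun x => minus (s m x) (s n x)) < eps) ->
  exists f : X -> E, summing Z Y f /\
    is_lim_seq (fun n => summing_norm Z Y (fun x => minus (s n x) (f x))) 0.
Proof.
  intros HZ Hs HC.
  assert (HNZ := seqs_normed Z X); assert (HNY := seqs_normed Y E).
  assert (Hconv : forall x, member (Z X) x -> exists l, member (Y E) l /\
            is_lim_seq (fun n => size (Y E) (minus (induced (s n) x) l)) 0).
  { intros x Hx; apply (size_complete (seqs_banach Y E)).
    { intros n; now apply (Hs n). }
    intros eps; assert (Hx0 := size_ge0 HNZ x Hx).
    (* Adding 1 keeps the denominator positive when [x] has size 0 and leaves room for the strict
       inequality. *)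
    assert (He : 0 < eps / (size (Z X) x + 1))
      by (apply Rdiv_lt_0_compat; [apply cond_pos | lra]).
    destruct (HC (mkposreal _ He)) as [N HN]; exists N; intros m n Hm Hn.
    specialize (HN m n Hm Hn); simpl in HN.
    apply Rle_lt_trans with (summing_norm Z Y (fun t => minus (s m t) (s n t))
                             * size (Z X) x).
    - apply (lipschitz_bound0 HNZ HNY
               (induced (fun t => minus (s m t) (s n t)))); [| easy].
      apply (lipschitz0_minus HNZ HNY); apply Hs.
    - apply Rle_lt_trans with (eps / (size (Z X) x + 1) * size (Z X) x).
      + apply Rmult_le_compat_r; lra.
      + apply Rlt_le_trans with (eps / (size (Z X) x + 1) * (size (Z X) x + 1)).
        * apply Rmult_lt_compat_l; lra.
        * right; field; lra. }
  assert (Hcoord : forall x l n, member (Z X) x -> member (Y E) l ->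
            is_lim_seq (fun m => size (Y E) (minus (induced (s m) x) l)) 0 ->
            is_lim_seq (fun m => norm (minus (s m (x n)) (l n))) 0).
  { intros x l n Hx Hl Hlim.
    apply is_lim_seq_le_le with (3 := Hlim) (2 := is_lim_seq_const 0).
    intros m; split; [apply norm_ge_0 |].
    refine (seqs_coord Y E (minus (induced (s m) x) l) n _).
    apply (ns_minus HNY); [now apply (Hs m) | easy]. }
  (* A point of [X] is tested through its head sequence; coordinate 0 of the limit in [Y E] is the
     value sought. *)
  assert (Hpt : forall x, exists y : E,
            is_lim_seq (fun m => norm (minus (s m x) y)) 0).
  { intros x; destruct (Hconv _ (head_seq_member Z X x)) as (l & Hl & Hlim).
    exists (l 0%nat).
    exact (Hcoord _ l 0%nat (head_seq_member Z X x) Hl Hlim). }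
  (* The limits are only known to exist, so a choice principle assembles them into a function. *)
  set (f := fun x => proj1_sig (constructive_indefinite_description _ (Hpt x))).
  assert (Hf : forall x, is_lim_seq (fun m => norm (minus (s m x) (f x))) 0)
    by (intros x; apply (proj2_sig (constructive_indefinite_description _ (Hpt x)))).
  (* The limit [l] in [Y E] and [induced f x] agree in every coordinate by uniqueness of limits in
     [E]; hence membership and convergence in [Y E] pass from [l] to [induced f x]. *)
  assert (Hind : forall x, member (Z X) x -> member (Y E) (induced f x) /\
            is_lim_seq (fun m => size (Y E) (minus (induced (s m) x) (induced f x))) 0).
  { intros x Hx; destruct (Hconv x Hx) as (l & Hl & Hlim).
    replace (induced f x) with l; [easy |].
    apply functional_extensionality; intros n.
    apply norm_limit_unique with (fun m => s m (x n)); [now apply Hcoord | apply Hf]. }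
  destruct (lipschitz0_limit HNZ HNY (fun n => induced (s n)) (induced f))
    as [Hlip Hlim].
  - intros n; apply Hs.
  - exact HC.
  - intros x Hx; now apply Hind.
  - apply functional_extensionality; intros n.
    apply norm_limit_unique with (fun m => s m zero); [apply Hf |].
    apply is_lim_seq_ext with (fun _ => 0); [| apply is_lim_seq_const].
    intros m; destruct (Hs m) as [(_ & H0 & _) _]; symmetry.
    exact (eq_trans (f_equal (fun z : E => norm (minus z zero)) H0)
                    (size_minus_self (whole_normed k E) zero)).
  - intros x Hx; now apply Hind.
  - exists f; split; [now apply summing_of_induced | exact Hlim].
Qed.

(** * Rank-one maps and composition *)

(** The factorisation bounds the norm above by [norm y * (1 * Lip h)]. Below, [induced_Lip] reduces
    the claim to [Lip h * norm y <= Lip hy], which holds because each increment of [hy] is the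
    increment of [h] times [y]. *)
Lemma summing_rank_one (Z Y : sequence_class k) (X E : CompleteNormedModule k)
    (h : X -> scalar_space k) (y : E) :
  lipschitz_stable Z -> lipschitz_stable Y ->
  (forall a : nat -> scalar_space k,
     member (Z (scalar_space k)) a ->
     member (Y (scalar_space k)) a /\
     size (Y (scalar_space k)) a <= size (Z (scalar_space k)) a) ->
  Lip0 h ->
  let hy : X -> E := fun x => scal (h x : k) y in
  summing Z Y hy /\ summing_norm Z Y hy = Lip h * norm y.
Proof.
  intros HZ HY HZY Hh hy.
  assert (HNX := whole_normed k X); assert (HNE := whole_normed k E).
  assert (HNK := whole_normed k (scalar_space k)).
  assert (Hinc : forall a b, member (Z (scalar_space k)) a ->
    member (Z (scalar_space k)) b ->
    size (Y (scalar_space k)) (minus a b) <=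
      1 * size (Z (scalar_space k)) (minus a b)).
  { intros a b Ha Hb; rewrite Rmult_1_l.
    now apply HZY, (ns_minus (seqs_normed Z _)). }
  (* The inclusion of [Z] into [Y] over the scalars, as a map of Lipschitz constant at most 1. *)
  assert (Hid : lipschitz0 (Z (scalar_space k)) (Y (scalar_space k)) (fun a => a)).
  { split; [intros a Ha; now apply HZY |]; split; [easy | now exists 1]. }
  assert (Hid1 := lipschitz_const_le (seqs_normed Z _) (fun a => a) 1 Rle_0_1 Hinc).
  destruct (stable_induced Z X _ h HZ Hh) as [Hh1 Hh2].
  destruct (line_Lip k E y) as [Hy Hy'].
  destruct (stable_induced Y _ E _ HY Hy) as [Hy1 Hy2].
  destruct (lipschitz0_comp (seqs_normed Z _) (seqs_normed Z _) (seqs_normed Y _)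
              _ _ Hh1 Hid) as [Hc Hcn].
  destruct (lipschitz0_comp (seqs_normed Z _) (seqs_normed Y _) (seqs_normed Y _)
              _ _ Hc Hy1) as [Hd Hdn].
  assert (Hsum : lipschitz0 (Z X) (Y E) (induced hy)) by exact Hd.
  destruct (induced_Lip Z Y X E hy HZ Hsum) as [Hhy Hhyn].
  split; [now apply summing_of_induced |].
  assert (H0 : 0 <= Lip h) by (apply (lipschitz_const_ge0 HNX HNK); easy).
  apply Rle_antisym.
  - rewrite Rmult_comm.
    apply Rle_trans with (1 := Hdn); rewrite Hy2; rewrite Hh2 in Hcn.
    apply Rmult_le_compat; [| | easy | nra].
    + apply (lipschitz_const_ge0 HNK HNE); easy.
    + apply (lipschitz_const_ge0 (seqs_normed Z _) (seqs_normed Y _)); apply Hc.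
  - apply Rle_trans with (2 := Hhyn).
    (* For [y] of norm 0 the left side vanishes; otherwise division by [norm y] turns the goal into
       a bound on the increments of [h]. *)
    destruct (norm_ge_0 y) as [Hpos | Hz].
    2: { rewrite <- Hz, Rmult_0_r; apply (lipschitz_const_ge0 HNX HNE); easy. }
    apply Rle_div_r; [easy |].
    apply (lipschitz_const_le (B := whole (scalar_space k)) HNX h).
    { apply Rdiv_le_0_compat; [apply (lipschitz_const_ge0 HNX HNE); easy | easy]. }
    intros u v _ _.
    assert (H := lipschitz_bound HNX HNE hy u v Hhy I I).
    unfold hy in H at 1 2; rewrite <- scal_minus_distr_r in H.
    simpl in H; rewrite norm_scal_eq in H.
    apply Rmult_le_reg_r with (1 := Hpos).
    apply Rle_trans with (1 := H); right; unfold Lip; simpl; field; lra.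
Qed.

(** By stability the two outer operators have constants [Lip h] and [Lip T], and
    [Lip T <= op_norm T] since [T] is linear. *)
Lemma summing_comp (Z Y : sequence_class k) (X0 X E E0 : CompleteNormedModule k)
    (T : E -> E0) (f : X -> E) (h : X0 -> X) :
  lipschitz_stable Z -> lipschitz_stable Y ->
  is_linear T -> summing Z Y f -> Lip0 h ->
  let g : X0 -> E0 := fun x => T (f (h x)) in
  summing Z Y g /\
  summing_norm Z Y g <= op_norm T * summing_norm Z Y f * Lip h.
Proof.
  intros HZ HY HT [_ Hf] Hh g.
  destruct (linear_Lip k E E0 T HT) as [HTL HTn].
  destruct (stable_induced Z _ _ h HZ Hh) as [Hh1 Hh2].
  destruct (stable_induced Y _ _ T HY HTL) as [HT1 HT2].
  destruct (lipschitz0_comp (seqs_normed Z _) (seqs_normed Z _) (seqs_normed Y _)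
              _ _ Hh1 Hf) as [Hc Hcn].
  destruct (lipschitz0_comp (seqs_normed Z _) (seqs_normed Y _) (seqs_normed Y _)
              _ _ Hc HT1) as [Hd Hdn].
  split; [now apply summing_of_induced |].
  apply Rle_trans with (1 := Hdn); rewrite HT2, Rmult_assoc; rewrite Hh2 in Hcn.
  apply Rmult_le_compat; [| | easy | easy].
  - apply (lipschitz_const_ge0 (whole_normed k E) (whole_normed k E0)); easy.
  - apply (lipschitz_const_ge0 (seqs_normed Z _) (seqs_normed Y _)); apply Hc.
Qed.

(** * The Banach space structure and the ideal axioms *)

Lemma summing_banach (Z Y : sequence_class k) (X E : CompleteNormedModule k) :
  lipschitz_stable Z -> banach_subspace (summing_maps Z Y X E).
Proof.
  intros HZ.
  assert (HNZ := seqs_normed Z X); assert (HNY := seqs_normed Y E).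
  assert (HNX := whole_normed k X); assert (HNE := whole_normed k E).
  assert (Hscal : forall (a : k) (f : X -> E), summing Z Y f ->
    summing Z Y (fun x => scal a (f x)) /\
    summing_norm Z Y (fun x => scal a (f x)) <= abs a * summing_norm Z Y f).
  { intros a f [_ Hf].
    destruct (lipschitz0_scal HNZ HNY a _ Hf) as [H1 H2].
    split; [now apply summing_of_induced | exact H2]. }
  split.
  - apply summing_of_induced; [easy |]; exact (lipschitz0_zero HNY).
  - intros f g [_ Hf] [_ Hg]; apply summing_of_induced; [easy |].
    exact (proj1 (lipschitz0_plus HNZ HNY _ _ Hf Hg)).
  - intros a f Hf; now apply Hscal.
  (* Definiteness: [Lip f] is at most the summing norm, here 0, and
     [norm (f x) <= Lip f * norm x]. *)
  - intros f [Hf Hf'] H0; apply functional_extensionality; intros x.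
    destruct (induced_Lip Z Y X E f HZ Hf') as [_ Hn].
    assert (H := lipschitz_bound0 HNX HNE f x Hf I); simpl in H0, H.
    apply (ns_eq0 _ HNE (f x) I), Rle_antisym; [| exact (norm_ge_0 (f x))].
    apply Rle_trans with (1 := H).
    rewrite H0 in Hn; assert (H1 := norm_ge_0 x); unfold Lip in Hn; nra.
  (* For [a <> zero] the missing inequality comes from [Hscal] applied to an inverse of [a] and to
     [scal a f]; for [a = zero] the right side is 0. *)
  - intros a f Hf; apply Rle_antisym; [now apply Hscal |].
    destruct (Hscal a f Hf) as [Haf _].
    destruct (classic (a = zero)) as [Ha | Ha].
    + assert (Ha0 : abs a = 0) by (rewrite Ha; exact abs_zero).
      rewrite Ha0, Rmult_0_l.
      apply (lipschitz_const_ge0 HNZ HNY), Haf.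
    + destruct (scalar_inverse k a Ha) as (b & Hba & Hb).
      destruct (Hscal b _ Haf) as [_ H].
      replace (fun x => scal b (scal a (f x))) with f in H.
      * apply Rle_trans with (1 := Rmult_le_compat_l _ _ _ (abs_ge_0 a) H).
        rewrite <- Rmult_assoc, (Rmult_comm (abs a) (abs b)), Hb.
        right; apply Rmult_1_l.
      * apply functional_extensionality; intros x.
        now rewrite scal_assoc, Hba, scal_one.
  - intros f g [_ Hf] [_ Hg].
    exact (proj2 (lipschitz0_plus HNZ HNY _ _ Hf Hg)).
  - intros s Hs HC; exact (summing_complete Z Y X E s HZ Hs HC).
Qed.

End SequenceClasses.

Theorem theorem2p11 (k : scalar_field) (Z Y : sequence_class k)
    (hZ : lipschitz_stable Z) (hY : lipschitz_stable Y)
    (hZY : forall a : nat -> scalar_space k,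
       member (Z (scalar_space k)) a ->
       member (Y (scalar_space k)) a /\
       size (Y (scalar_space k)) a <= size (Z (scalar_space k)) a) :
  banach_lipschitz_ideal (summing_maps Z Y).
Proof.
  split.
  - intros X E f [Hf _]; exact Hf.
  - intros X E f [_ Hf].
    apply (lipschitz_const_ge0 (seqs_normed Z X) (seqs_normed Y E)), Hf.
  - intros X E; now apply summing_banach.
  - intros X E f [_ Hf]; now apply induced_Lip.
  - intros X E h y Hh; now apply summing_rank_one.
  - intros X0 X E E0 T f h HT Hf Hh; now apply summing_comp.
Qed.
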